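(* Let $t$ be a rational integer congruent to $-5$, $1$, $3$, or $9$ modulo $25$. If the polynomial $$Y^4+5(t^2+16)Y^2+5(t^2+16)(t-2)^2$$ is irreducible over $\mathbb{Q}$, then for $y$ a root of it, $\mathbb{Q}(y)$ is a cyclic extension of $\mathbb{Q}$; and if $$p(x)=x^5+10x^3-5tx^2-15x-t^2+t-16$$ is likewise irreducible over $\mathbb{Q}$, then the splitting field of $p(x)$ over $\mathbb{Q}(y)$ is an unramified cyclic extension of $\mathbb{Q}(y)$.
   Context: A cyclic extension is a Galois extension with cyclic Galois group. *)

(* Defs.v *)
From HB Require Import structures.
From mathcomp Require Import all_boot all_order all_algebra.
From mathcomp Require Import all_fingroup all_solvable all_field.

Set Implicit Arguments.
Unset Strict Implicit.
Unset Printing Implicit Defensive.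

Import Order.TTheory GRing.Theory Num.Theory.
Local Open Scope ring_scope.

Definition quarticP (t : int) : {poly rat} :=
  let T : rat := t%:~R in
  'X^4 + (5 * (T ^+ 2 + 16))%:P * 'X^2
       + (5 * (T ^+ 2 + 16) * (T - 2) ^+ 2)%:P.

Definition quinticP (t : int) : {poly rat} :=
  let T : rat := t%:~R in
  'X^5 + 10%:P * 'X^3 - (5 * T)%:P * 'X^2 - 15%:P * 'X
       + (- T ^+ 2 + T - 16)%:P.

(* Number fields are subfields of an ambient finite normal extension L of the
   rationals; every finite family of number fields has such an ambient L. *)

Definition cyclic_extension (L : splittingFieldType rat) (K E : {subfield L})
  : Prop := galois K E /\ cyclic 'Gal(E / K).

Section Ramification.
Variable L : splittingFieldType rat.
Implicit Types (K E : {subfield L}) (I J P : L -> Prop).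

Definition ring_of_integers E (x : L) : Prop :=
  x \in E /\ integralOver (intr : int -> L) x.

Definition is_ideal E I : Prop :=
  [/\ forall x, I x -> ring_of_integers E x,
      I 0,
      forall x y, I x -> I y -> I (x + y)
    & forall a x, ring_of_integers E a -> I x -> I (a * x)].

Definition is_prime_ideal E P : Prop :=
  [/\ is_ideal E P, ~ P 1
    & forall a b, ring_of_integers E a -> ring_of_integers E b ->
        P (a * b) -> P a \/ P b].

(* Finite sums of products a * b with a in I and b in J. In particular
   prod_set p (ring_of_integers E) is the extension of p to the integers of
   E. *)
Definition prod_set I J (x : L) : Prop :=
  exists2 s : seq (L * L),
    (forall ab, ab \in s -> I ab.1 /\ J ab.2) & x = \sum_(ab <- s) ab.1 * ab.2.

Fixpoint ideal_exp E P (n : nat) : L -> Prop :=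
  if n is m.+1 then prod_set P (ideal_exp E P m) else ring_of_integers E.

(* The prime of K below P. *)
Definition contraction K P (x : L) : Prop := x \in K /\ P x.

(* e is the exponent of P in the extension to E of the prime of K below P;
   in a Dedekind ring, P ^ n divides an ideal iff it contains it. *)
Definition is_ramification_index K E P (e : nat) : Prop :=
  let pE := prod_set (contraction K P) (ring_of_integers E) in
  (forall x, pE x -> ideal_exp E P e x) /\
  ~ (forall x, pE x -> ideal_exp E P e.+1 x).

(* Residue fields are finite, so no separability condition is needed. *)
Definition unramified_at_finite_places K E : Prop :=
  forall P, is_prime_ideal E P -> (exists2 x, P x & x != 0) ->
    is_ramification_index K E P 1.

(* Every complex embedding of E extends to L, so the archimedean places of E
   are the restrictions of embeddings of L. *)
Definition unramified_at_infinite_places K E : Prop :=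
  forall s : {rmorphism L -> algC},
    (forall x, x \in K -> s x \is Num.real) ->
    forall x, x \in E -> s x \is Num.real.

Definition unramified_extension K E : Prop :=
  unramified_at_finite_places K E /\ unramified_at_infinite_places K E.

End Ramification.

(* Main.v *)
Require Import Defs.
From HB Require Import structures.
From mathcomp Require Import all_boot all_order all_algebra.
From mathcomp Require Import all_fingroup all_solvable all_field.
From mathcomp Require Import zify ring.
From Stdlib Require Import Classical.

Set Implicit Arguments.
Unset Strict Implicit.
Unset Printing Implicit Defensive.

Import Order.TTheory GRing.Theory Num.Theory.
Local Open Scope ring_scope.

(* Write A = t^2 + 16 and K = Q(y).  Then y^2 = (- 5 A + (t + 8) d) / 2 with
   d^2 = 5 A, the conjugates of y are +-y and +-(t - 2) d / y, and
   y |-> (t - 2) d / y has order 4, so K is cyclic.  A second root of p is a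
   rational function of x, d and y, so K(x) has a nontrivial automorphism over
   K; as p stays irreducible over K, of degree prime to 5, E = K(x) is cyclic of
   degree 5.
   K is totally imaginary, so only finite places P of E matter.  If P ramifies,
   its inertia group is the whole Galois group and every integer w of E is
   congruent mod P to its conjugates, so that the characteristic polynomial of w
   over K is (X - w)^5 mod P.  For w = x this forces 5 into P.  When 5 is in P,
   the class of t mod 25 provides an affine function w of x over K which is
   integral and whose characteristic polynomial has a nonzero coefficient of X
   or X^4 mod P, although (X - w)^5 = X^5 - w^5 there. *)

(** * A second root of the quintic *)

(* Over Q(d, x), the quartic p(X) / (X - x) splits into two quadratics whose
   root sums are (- x + delta) / 2 and (- x - delta) / 2 and whose root products
   are mu + nu and mu - nu; r ^ 2 is the discriminant of the first one.  The
   numerators of delta, nu and r over D = p'(x) / 5 come from their traces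
   against powers of x, by Euler's formula. *)
Lemma quintic_second_root (F : fieldType) (t x d y : F) :
    let p X := X ^+ 5 + 10 * X ^+ 3 - 5 * t * X ^+ 2 - 15 * X
               + (- t ^+ 2 + t - 16) in
    let D := x ^+ 4 + 6 * x ^+ 2 - 2 * t * x - 3 in
    let N := x ^+ 2 - 4 * x + t + 1 in
    let M := 2 * (10 + d) * x ^+ 2 - 2 * (5 * t + d) * x
             + (t - 2) * (t + 2 + d) in
    let z := (d * N + y * M / (t - 2)) / (4 * D) - x / 4 in
    2 != 0 :> F -> 5 != 0 :> F -> t - 2 != 0 -> D != 0 -> p x = 0 ->
    d ^+ 2 = 5 * (t ^+ 2 + 16) ->
    2 * y ^+ 2 = (t + 8) * d - 5 * (t ^+ 2 + 16) ->
  z != x /\ p z = 0.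
Proof.
move=> p D N M z n2 n5 nt nD px d2 y2.
have n4 : 4 != 0 :> F by rewrite (_ : 4 = 2 * 2) ?mulf_neq0 //; ring.
have n8 : 8 != 0 :> F by rewrite (_ : 8 = 2 * 4) ?mulf_neq0 //; ring.
have x5 : x ^+ 5 = - (10 * x ^+ 3 - 5 * t * x ^+ 2 - 15 * x
                      + (- t ^+ 2 + t - 16)).
  by apply/eqP; rewrite -subr_eq0 opprK; apply/eqP; rewrite -[RHS]px /p; ring.
pose delta := d * N / D.
pose nu := d * (- x ^+ 3 - 2 * x ^+ 2 - 5 * x + t - 2) / (2 * D).
(* The coefficient x^2 + 10 of X^2 in p(X) / (X - x) determines [mu]; the next two identities match
   the coefficients of X and 1. *)
pose mu := (3 * x ^+ 2 + 40 + delta ^+ 2) / 8.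
pose r := y * M / ((t - 2) * 2 * D).
have coefX : x * mu + delta * nu = x ^+ 3 + 10 * x - 5 * t.
  apply: (mulIf (mulf_neq0 n8 (expf_neq0 2 nD))).
  transitivity (x * (3 * x ^+ 2 + 40) * D ^+ 2 + x * (d * N) ^+ 2
      + 4 * d ^+ 2 * N * (- x ^+ 3 - 2 * x ^+ 2 - 5 * x + t - 2)).
    by rewrite /mu /nu /delta; field; rewrite ?n2 ?n4 ?n8 ?nt ?nD.
  by rewrite /N /D; ring: d2 x5.
have coef1 : mu ^+ 2 - nu ^+ 2 = x ^+ 4 + 10 * x ^+ 2 - 5 * t * x - 15.
  apply: (mulIf (mulf_neq0 (expf_neq0 2 n8) (expf_neq0 4 nD))).
  transitivity (((3 * x ^+ 2 + 40) * D ^+ 2 + d ^+ 2 * N ^+ 2) ^+ 2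
      - 16 * d ^+ 2 * (- x ^+ 3 - 2 * x ^+ 2 - 5 * x + t - 2) ^+ 2 * D ^+ 2).
    by rewrite /mu /nu /delta; field; rewrite ?n2 ?n4 ?n8 ?nt ?nD.
  by rewrite d2 /N /D; ring: x5.
have disc : r ^+ 2 = (- x + delta) ^+ 2 / 4 - 4 * (mu + nu).
  apply: (mulIf (mulf_neq0 (mulf_neq0 n8 (expf_neq0 2 nD)) (expf_neq0 2 nt))).
  transitivity (2 * y ^+ 2 * M ^+ 2).
    by rewrite /r; field; rewrite ?n2 ?n4 ?n8 ?nt ?nD.
  transitivity (2 * (t - 2) ^+ 2 * (- (5 * x ^+ 2 + 80) * D ^+ 2
     - 2 * x * d * N * D - d ^+ 2 * N ^+ 2
     - 8 * d * (- x ^+ 3 - 2 * x ^+ 2 - 5 * x + t - 2) * D)); last first.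
    by rewrite /mu /nu /delta; field; rewrite ?n2 ?n4 ?n8 ?nt ?nD.
  by rewrite y2 /M /N /D; ring: d2 x5.
pose Q X := X ^+ 4 + x * X ^+ 3 + (x ^+ 2 + 10) * X ^+ 2
            + (x ^+ 3 + 10 * x - 5 * t) * X
            + (x ^+ 4 + 10 * x ^+ 2 - 5 * t * x - 15).
have pE X : p X = (X - x) * Q X by rewrite -[LHS]subr0 -px /p /Q; ring.
have Qz : Q z = 0.
  (* [z] is the root of the first quadratic given by the quadratic formula. *)
  have zE : z = ((- x + delta) / 2 + r) / 2.
    by rewrite /z /delta /r; field; rewrite ?n2 ?n4 ?n8 ?nt ?nD.
  transitivity ((z ^+ 2 - (- x + delta) / 2 * z + (mu + nu))
               * (z ^+ 2 - (- x - delta) / 2 * z + (mu - nu))).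
    by rewrite /Q -coefX -coef1 /mu; field; rewrite ?n2 ?n4 ?n8 ?nt ?nD.
  suff -> : z ^+ 2 - (- x + delta) / 2 * z + (mu + nu) = 0 by rewrite mul0r.
  transitivity ((r ^+ 2 - ((- x + delta) ^+ 2 / 4 - 4 * (mu + nu))) / 4).
    by rewrite zE; field; rewrite ?n2 ?n4 ?n8 ?nt ?nD.
  by rewrite disc subrr mul0r.
split; last by rewrite pE Qz mulr0.
(* Q(x) = p'(x) = 5 D is nonzero, so x is not a root of Q. *)
apply/eqP=> zx; have : 5 * D = Q z by rewrite zx /Q /D; ring.
by apply/eqP; rewrite Qz mulf_neq0.
Qed.
(** * Galois theory over the rationals *)

Section RationalExtensions.
Variable L : splittingFieldType rat.
Implicit Types (K E : {subfield L}) (x y z : L).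

Lemma intrL_eq0 (n : int) : (n%:~R == 0 :> L) = (n == 0).
Proof. by rewrite -(rmorph_int (in_alg L)) fmorph_eq0 intr_eq0. Qed.

Lemma natrL_neq0 (n : nat) : n != 0%N -> n%:R != 0 :> L.
Proof. by move=> n0; rewrite pmulrn intrL_eq0. Qed.

Lemma adjoin_degree_irreducible (p : {poly rat}) x :
    irreducible_poly p -> root (map_poly (in_alg L) p) x ->
  adjoin_degree 1 x = (size p).-1.
Proof.
move=> [_ irr_p] px0.
have /polyOver1P[q q_min] := minPolyOver 1 x.
have qp : q %| p.
  rewrite -(dvdp_map (in_alg L)) -q_min minPoly_dvdp //.
  exact: alg_polyOver.
have sq : size q = (adjoin_degree 1 x).+1.
  by rewrite -(size_minPoly 1 x) q_min size_map_poly.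
have /eqp_size <- : q %= p by apply: irr_p => //; rewrite sq.
by rewrite sq.
Qed.

(** The K-embedding of K(x) with x |-> z has its image in K(x) because z lies there, so it is an
    automorphism even if K(x) / K is not normal. *)
Lemma gal_adjoin_root K x z :
    z \in <<K; x>>%VS -> root (minPoly K x) z ->
  exists2 s : gal_of <<K; x>>, s \in 'Gal(<<K; x>> / K)%g & s x = z.
Proof.
move=> Kx_z root_z.
have root_z1 : root (map_poly (\1%VF : 'End(L)) (minPoly K x)) z.
  by rewrite (eq_map_poly (fun u => id_lfunE u)) map_poly_id.
have hom1 := kHom1 K K.
have homf := kHomExtendP (subvv K) hom1 root_z1.
have [|s galK_s sE] := @kAut_to_gal _ _ K <<K; x>>%AS (kHomExtend K \1 x z).
  rewrite kAutE homf /=; apply/subvP=> _ /memv_imgP[u Ku ->].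
  case/Fadjoin_polyP: Ku => p Kp ->.
  rewrite (kHomExtend_poly hom1 root_z1 Kp) (kHom_poly_id hom1 Kp).
  by rewrite rpred_horner // (polyOverS (@subvP_adjoin _ _ K x)) ?memv_adjoin.
exists s => //; rewrite -sE ?memv_adjoin //.
exact: kHomExtend_val hom1 root_z1.
Qed.

(** By Artin, E has degree #[s] over the fixed field of s, which contains K; E / K need not be
    Galois. *)
Lemma order_gal_dvdn K E (s : gal_of E) :
  (K <= E)%VS -> s \in 'Gal(E / K)%g -> (#[s]%g %| \dim_K E)%N.
Proof.
move=> sKE galK_s.
have sKF : (K <= fixedField <[s]>%g)%VS by rewrite -galois_connection ?cycle_subG.
have sFE : (fixedField <[s]>%g <= E)%VS by apply: fixedField_bound.
have := dim_sup_field sFE; rewrite -(dim_fixedField <[s]>%G) (dim_sup_field sKF).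
rewrite {1}(dim_sup_field sKE) mulnA => /eqP; rewrite eqn_pmul2r ?adim_gt0 //.
by move/eqP->; apply: dvdn_mulr.
Qed.

(** The fixed field of s contains K and has the same codegree in E, so it equals K, and Artin's
    theorem applies. *)
Lemma galois_cyclic_of_order K E (s : gal_of E) :
    (K <= E)%VS -> s \in 'Gal(E / K)%g -> #[s]%g = \dim_K E ->
  galois K E /\ 'Gal(E / K)%g = <[s]>%g.
Proof.
move=> sKE galK_s os; pose F := fixedField <[s]>%g.
have sFE : (F <= E)%VS by apply: fixedField_bound.
have sKF : (K <= F)%VS.
  by rewrite -galois_connection // cycle_subG.
have KF : K = F :> {vspace L}.
  apply/eqP; rewrite eqEdim sKF /=.
  have /eqP := dim_sup_field sFE.
  rewrite -[\dim_F E](dim_fixedField <[s]>%G) [#|_|]os.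
  by rewrite [X in X == _](dim_sup_field sKE) eqn_pmul2l -?os // => /eqP->.
have KFa : K = [aspace of F] by apply: val_inj.
rewrite KFa; split; first exact: fixedField_galois.
exact: (gal_fixedField <[s]>%G).
Qed.

End RationalExtensions.
(** * Rings of integers and their prime ideals *)

Section Integers.
Variables (L : splittingFieldType rat) (E : {subfield L}).
Local Notation O := (ring_of_integers E).

Lemma integers_int (n : int) : O n%:~R.
Proof. by split; [exact: rpred_int | exact: integral_id]. Qed.

Lemma integers_nat (n : nat) : O n%:R.
Proof. exact: (integers_int n). Qed.

Lemma integers0 : O 0. Proof. exact: (integers_nat 0). Qed.
Lemma integers1 : O 1. Proof. exact: (integers_nat 1). Qed.

Lemma integersD x y : O x -> O y -> O (x + y).
Proof. by move=> [? ?] [? ?]; split; [exact: rpredD | exact: integral_add]. Qed.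

Lemma integersN x : O x -> O (- x).
Proof. by move=> [? ?]; split; [rewrite rpredN | exact: integral_opp]. Qed.

Lemma integersB x y : O x -> O y -> O (x - y).
Proof. by move=> Ox /integersN; apply: integersD. Qed.

Lemma integersM x y : O x -> O y -> O (x * y).
Proof. by move=> [? ?] [? ?]; split; [exact: rpredM | exact: integral_mul]. Qed.

Lemma integersX x n : O x -> O (x ^+ n).
Proof.
move=> Ox; elim: n => [|n IHn]; first exact: integers1.
by rewrite exprS; apply: integersM.
Qed.

Lemma integers_sum (I : eqType) (r : seq I) (F : I -> L) :
  (forall i, i \in r -> O (F i)) -> O (\sum_(i <- r) F i).
Proof.
move=> OF; rewrite big_seq; elim/big_ind: _ => //.
  exact: integers0.
exact: integersD.
Qed.

Lemma integers_gal (s : gal_of E) x : O x -> O (s x).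
Proof.
move=> [Ex [q mon_q qx0]]; split; first exact: memv_gal.
exists q => //; move/rootP: qx0 => qx0; apply/rootP.
rewrite -(rmorph0 s) -qx0 -horner_map /= -map_poly_comp.
congr _.[_]; apply: eq_map_poly => n /=; by rewrite rmorph_int.
Qed.

Lemma integers_root (p : {poly L}) x :
  p \is monic -> (forall i, O p`_i) -> x \in E -> root p x -> O x.
Proof.
move=> mon_p Op Ex px0; split=> //; apply: integral_root_monic mon_p px0 _.
by apply/integral_poly => i; case: (Op i).
Qed.

Lemma integers_horner (p : {poly int}) x :
  O x -> O (map_poly intr p).[x].
Proof.
move=> Ox; elim/poly_ind: p => [|p c IHp].
  by rewrite rmorph0 horner0; apply: integers0.
rewrite rmorphD rmorphM /= map_polyX map_polyC !hornerE.
by apply: integersD; [apply: integersM | apply: integers_int].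
Qed.

Section Ideal.
Variable P : L -> Prop.
Hypothesis idP : is_ideal E P.

Lemma ideal_integers x : P x -> O x. Proof. by case: idP => + _ _ _; apply. Qed.
Lemma ideal0 : P 0. Proof. by case: idP. Qed.
Lemma idealD x y : P x -> P y -> P (x + y).
Proof. by case: idP => _ _ + _; apply. Qed.
Lemma idealMl a x : O a -> P x -> P (a * x).
Proof. by case: idP => _ _ _; apply. Qed.
Lemma idealMr a x : O a -> P x -> P (x * a).
Proof. by rewrite mulrC; apply: idealMl. Qed.
Lemma idealN x : P x -> P (- x).
Proof. by move=> Px; rewrite -mulN1r; apply: idealMl (integersN integers1) Px. Qed.
Lemma idealB x y : P x -> P y -> P (x - y).
Proof. by move=> Px /idealN; apply: idealD. Qed.

Lemma ideal_sum (I : eqType) (r : seq I) (Q : pred I) (F : I -> L) :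
  (forall i, i \in r -> Q i -> P (F i)) -> P (\sum_(i <- r | Q i) F i).
Proof.
move=> PF; rewrite big_seq_cond; elim/big_ind: _ => [|x y|i /andP[ri Qi]].
- exact: ideal0.
- exact: idealD.
- exact: PF.
Qed.

Lemma prod_set_ideal J x : (forall y, J y -> O y) -> prod_set P J x -> P x.
Proof.
move=> OJ [s PJs ->]; apply: ideal_sum => ab s_ab _.
by have [Pa /OJ Ob] := PJs _ s_ab; apply: idealMr.
Qed.

End Ideal.

Section PrimeIdeal.
Variable P : L -> Prop.
Hypothesis prP : is_prime_ideal E P.

Let idP : is_ideal E P. Proof. by case: prP. Qed.

Lemma prime_ideal1 : ~ P 1. Proof. by case: prP. Qed.

Lemma prime_idealM a b : O a -> O b -> P (a * b) -> P a \/ P b.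
Proof. by case: prP => _ _; apply. Qed.

Lemma prime_ideal_notM a b : O a -> O b -> ~ P a -> ~ P b -> ~ P (a * b).
Proof. by move=> Oa Ob nPa nPb /(prime_idealM Oa Ob)[]. Qed.

Lemma prime_idealX a n : O a -> P (a ^+ n) -> P a.
Proof.
move=> Oa; elim: n => [|n IHn]; first by move/prime_ideal1.
by rewrite exprS => /(prime_idealM Oa (integersX n Oa))[].
Qed.

Lemma prime_ideal_int x : P x -> x != 0 -> exists2 n : int, n != 0 & P n%:~R.
Proof.
move=> Px x0; have Ox := ideal_integers idP Px.
have [q /monic_neq0 q0] := Ox.2.
elim/poly_ind: q q0 => [|q c IHq]; first by rewrite eqxx.
rewrite rmorphD rmorphM /= map_polyX map_polyC /=.
have [->|c0] := eqVneq c 0.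
  rewrite !rmorph0 !addr0 mulf_eq0 negb_or => /andP[q0 _].
  by rewrite rootM rootX (negPf x0) orbF; apply: IHq.
move=> _ /rootP; rewrite !hornerE => qx; exists c => //.
have -> : c%:~R = - ((map_poly intr q).[x] * x).
  by apply/eqP; rewrite -addr_eq0 addrC qx.
by apply/(idealN idP)/(idealMl idP) => //; apply: integers_horner.
Qed.

Lemma prime_ideal_char x :
  P x -> x != 0 -> exists2 l : nat, prime l & P l%:R.
Proof.
move=> Px /(prime_ideal_int Px)[n n0 Pn].
have {Pn} : P `|n|%N%:R.
  case: n Pn {n0} => n //; rewrite NegzE mulrNz => /(idealN idP).
  by rewrite opprK.
have {n0} : (0 < `|n|)%N by rewrite absz_gt0.
move: `|n|%N => m; elim/ltn_ind: m => m IHm m0 Pm.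
have m1 : (1 < m)%N.
  by case: m m0 Pm {IHm} => [|[|m]] // _ /prime_ideal1.
have dm := pdiv_dvd m; move: Pm; rewrite -(divnK dm) natrM.
case/(prime_idealM (integers_nat _) (integers_nat _)) => [Pd|Pp].
  apply: IHm Pd; first by rewrite ltn_Pdiv ?prime_gt1 ?pdiv_prime.
  by rewrite divn_gt0 ?pdiv_gt0 // dvdn_leq.
by exists (pdiv m); rewrite ?pdiv_prime.
Qed.

(** Otherwise Bezout's identity would put 1 into P. *)
Lemma prime_ideal_dvdz (l : nat) (n : int) :
  prime l -> P l%:R -> P n%:~R -> (l %| n)%Z.
Proof.
move=> pr_l Pl Pn; rewrite dvdzE /=; have [//|ln] := boolP (l %| `|n|)%N; exfalso.
have cop : coprimez l n by rewrite coprimezE /= prime_coprime.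
have [u [v uv]] := Bezoutz l n.
apply: prime_ideal1; rewrite -[1]/((1 : int)%:~R) -(eqP cop) -uv.
rewrite rmorphD !rmorphM /=.
by apply: (idealD idP); apply: (idealMl idP) => //; apply: integers_int.
Qed.

End PrimeIdeal.
End Integers.

(** * Finite generation of ideals and Nakayama's lemma *)

Section Span.
Variables (L : splittingFieldType rat) (E : {subfield L}).
Local Notation O := (ring_of_integers E).

(** The coefficients range over the integers of E, not over Z. The recursion lets the head generator
    be eliminated first. *)
Fixpoint integer_span (s : seq L) (x : L) : Prop :=
  if s is a :: s' then exists2 c, O c & integer_span s' (x - c * a) else x = 0.

Lemma integer_span0 s : integer_span s 0.
Proof.
elim: s => //= a s IHs; exists 0; first exact: integers0.
by rewrite mul0r subr0.
Qed.

Lemma integer_spanD s x y :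
  integer_span s x -> integer_span s y -> integer_span s (x + y).
Proof.
elim: s x y => [|a s IHs] x y /= => [-> ->|]; first by rewrite addr0.
move=> [c Oc xc] [d Od yd]; exists (c + d); first exact: integersD.
by rewrite mulrDl opprD addrACA; apply: IHs.
Qed.

Lemma integer_spanM s c x : O c -> integer_span s x -> integer_span s (c * x).
Proof.
move=> Oc; elim: s x => [|a s IHs] x /= => [->|]; first by rewrite mulr0.
case=> d Od xd; exists (c * d); first exact: integersM.
by rewrite -mulrA -mulrBr; apply: IHs.
Qed.

Lemma integer_span_sum s (I : eqType) (r : seq I) (F : I -> L) :
  (forall i, i \in r -> integer_span s (F i)) ->
  integer_span s (\sum_(i <- r) F i).
Proof.
move=> sF; rewrite big_seq; elim/big_ind: _ => //.
  exact: integer_span0.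
exact: integer_spanD.
Qed.

Lemma mem_integer_span s a : a \in s -> integer_span s a.
Proof.
elim: s => //= b s IHs; rewrite inE => /predU1P[->|/IHs sa].
  exists 1; first exact: integers1.
  by rewrite mul1r subrr; apply: integer_span0.
exists 0; first exact: integers0.
by rewrite mul0r subr0.
Qed.

(** For s in O, linear independence over Z / l of the classes of s in O / l O. *)
Definition free_mod (l : nat) (s : seq L) :=
  forall (c : nat -> int) (o : L), O o ->
    \sum_(i < size s) (c i)%:~R * s`_i = l%:R * o ->
  forall i, (i < size s)%N -> (l %| c i)%Z.

(** Descent: the coefficients of an integral relation are divisible by l, and dividing by l gives
    another relation, so they are divisible by every power of l. *)
Lemma free_mod_free l s : (1 < l)%N -> free_mod l s -> free s.
Proof.
move=> l1 free_s.
have l0 : l%:R != 0 :> L by rewrite natrL_neq0 // -lt0n ltnW.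
have dvd_pow m (c : nat -> int) : \sum_(i < size s) (c i)%:~R * s`_i = 0 ->
    forall i, (i < size s)%N -> ((l ^ m)%N %| c i)%Z.
  elim: m c => [|m IHm] c c0 i ltis; first exact: dvd1z.
  have lc : forall i, (i < size s)%N -> (l %| c i)%Z.
    by apply: (free_s c 0); [exact: integers0 | rewrite c0 mulr0].
  have := IHm (fun i => (c i %/ l)%Z) _ i ltis.
  rewrite expnSr PoszM => dv; rewrite -(divzK (lc i ltis)) dvdz_mul ?dv //.
  apply: (mulfI l0); rewrite mulr0 -[RHS]c0 big_distrr /=.
  apply: eq_bigr => j _; rewrite mulrA; congr (_ * _).
  by rewrite -[in RHS](divzK (lc j (ltn_ord j))) rmorphM /= mulrC.
suff : free (in_tuple s) by [].
apply/freeP=> k k0 i.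
pose p : {poly rat} := \poly_(j < size s) (if insub j is Some j' then k j' else 0).
have pk (j : 'I_(size s)) : p`_j = k j by rewrite coef_poly ltn_ord valK.
have [q [a a0 pq]] := rat_poly_scale p.
have kq (j : 'I_(size s)) : k j = a%:~R^-1 * (q`_j)%:~R.
  by rewrite -pk pq coefZ coef_map.
have q0 : \sum_(j < size s) (q`_j)%:~R * s`_j = 0.
  transitivity ((a%:~R : rat) *: \sum_(j < size s) k j *: (in_tuple s)`_j).
    rewrite scaler_sumr; apply: eq_bigr => j _.
    by rewrite kq scalerA mulVKf ?intr_eq0 // scaler_int mulrzl.
  by rewrite k0 scaler0.
suff -> : k i = 0 by [].
rewrite kq; apply/eqP; rewrite mulf_eq0 intr_eq0 orbC; apply/orP; left.
apply: contraT => qi0.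
(* The exponent |q_i| is large enough, as n < l^n. *)
have := dvd_pow (absz q`_i) (fun j => q`_j) q0 i (ltn_ord i).
move/(dvdn_leq _); rewrite absz_gt0 leqNgt => /(_ qi0)/negP[].
exact: ltn_expl.
Qed.

Lemma free_mod_size l s : (1 < l)%N -> free_mod l s -> (size s <= \dim {:L})%N.
Proof.
by move=> l1 /(free_mod_free l1)/eqP <-; apply/dimvS/subvf.
Qed.

(* Lists of integers of E that are independent mod l are free over the
   rationals, so a maximal one exists in P; together with l, it generates P. *)
Lemma ideal_finite_generation (P : L -> Prop) (l : nat) :
    is_ideal E P -> prime l -> P l%:R ->
  exists2 s : seq L, (forall a, a \in s -> P a)
                     & forall x, P x -> integer_span s x.
Proof.
move=> idP pr_l Pl.
suff [s Ps] : exists2 s : seq L, (forall a, a \in s -> P a)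
    & forall x, P x -> integer_span (l%:R :: s) x.
  by exists (l%:R :: s) => // a; rewrite inE => /predU1P[->|/Ps].
have [//|no_s] := classic (exists2 s : seq L, (forall a, a \in s -> P a)
    & forall x, P x -> integer_span (l%:R :: s) x).
have [s [Ps]] : exists s : seq L, [/\ forall a, a \in s -> P a, free_mod l s
    & (size s = (\dim {:L}).+1)%N].
  elim: (_.+1) => [|n [s [Ps free_s size_s]]]; first by exists [::]; split.
  have [x Px nsx] : exists2 x, P x & ~ integer_span (l%:R :: s) x.
    apply: NNPP => no_x; apply: no_s; exists s => // x Px.
    by apply: NNPP => nsx; apply: no_x; exists x.
  exists (x :: s); split=> [a||]; last by rewrite /= size_s.
    by rewrite inE => /predU1P[->|/Ps].
  move=> c o Oo; rewrite big_ord_recl.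
  rewrite -/(\sum_(i < size s) (c i.+1)%:~R * s`_i) [nth _ _ _]/= => c_o.
  have Ox := ideal_integers idP Px.
  (* If l divides the coefficient of x, that term joins the multiple of l and a relation on s
     remains. Otherwise the coefficient is invertible mod l, which puts x in the span of l and s. *)
  have [lc0|lc0] := boolP (l %| c 0%N)%Z.
    case=> [|i] //=; rewrite ltnS; move: i.
    apply: (free_s (fun i => c i.+1) (o - (c 0%N %/ l)%Z%:~R * x)).
      by apply: integersB => //; apply: integersM => //; apply: integers_int.
    have c0E : (c 0%N)%:~R = l%:R * (c 0%N %/ l)%Z%:~R :> L.
      by rewrite -{1}(divzK lc0) rmorphM /= mulrC.
    by rewrite mulrBr -c_o c0E; ring.
  case: nsx; have cop : coprimez l (c 0%N).
    by rewrite coprimezE /= prime_coprime // -dvdzE.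
  have [u [v uv]] := Bezoutz l (c 0%N).
  have -> : x = (u%:~R * x + v%:~R * o) * l%:R
                 - v%:~R * (\sum_(i < size s) (c i.+1)%:~R * s`_i).
    have {1}-> : x = (u * l + v * c 0%N)%:~R * x by rewrite uv (eqP cop) mul1r.
    have -> : \sum_(i < size s) (c i.+1)%:~R * s`_i = l%:R * o - (c 0%N)%:~R * x.
      by rewrite -c_o; ring.
    by rewrite rmorphD !rmorphM /=; ring.
  exists (u%:~R * x + v%:~R * o).
    by apply: integersD; apply: integersM => //; apply: integers_int.
  rewrite addrC addKr -mulNr.
  apply: integer_spanM; first exact/integersN/integers_int.
  apply: integer_span_sum => i _.
  apply: integer_spanM; first exact: integers_int.
  by apply: mem_integer_span; apply: mem_nth.
move=> /(free_mod_size (prime_gt1 pr_l)) + size_s; rewrite size_s.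
by rewrite ltnn.
Qed.

(* Nakayama's lemma at P, eliminating the generators of P one at a time. *)
Lemma prime_ideal_not_idempotent (P : L -> Prop) (x : L) :
    is_prime_ideal E P -> P x -> x != 0 ->
  exists2 a, P a & forall e, O e -> ~ P e -> ~ prod_set P (prod_set P O) (e * a).
Proof.
move=> prP Px x0; have idP : is_ideal E P by case: prP.
have [l pr_l Pl] := prime_ideal_char prP Px x0.
have [s Ps gen_s] := ideal_finite_generation idP pr_l Pl.
apply: NNPP => no_a.
(* Otherwise P equals P^2 locally at P: each a in P has a multiple e a in P^2 with e outside P. *)
have sq a : P a -> exists e, [/\ O e, ~ P e & prod_set P (prod_set P O) (e * a)].
  move=> Pa; apply: NNPP => no_e; apply: no_a; exists a => // e Oe nPe Pea.
  by apply: no_e; exists e.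
(* Invariant of the elimination: s generates P up to a common denominator f outside P. With no
   generator left, f x = 0 forces f = 0, which is in P. *)
have : exists f, [/\ O f, ~ P f & forall a, P a -> integer_span s (f * a)].
  exists 1; split; [exact: integers1 | exact: prime_ideal1 prP |].
  by move=> a; rewrite mul1r; apply: gen_s.
elim: s Ps {gen_s} => [|a s IHs] Ps [f [Of nPf gen_f]].
  have /eqP := gen_f x Px; rewrite mulf_eq0 (negPf x0) orbF => /eqP f0.
  by apply: nPf; rewrite f0; exact: ideal0 idP.
apply: IHs => [b sb|]; first by apply: Ps; rewrite inE sb orbT.
have Pa : P a by apply: Ps; rewrite mem_head.
have [e [Oe nPe [r Pr ea]]] := sq a Pa.
(* e a is a sum of products p q with p and q in P, and f q is c a modulo the span of the remaining
   generators; b collects the p c. *)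
have [b Pb span_b] : exists2 b, P b & integer_span s (f * (e * a) - b * a).
  rewrite ea big_distrr /= {ea}.
  elim: r Pr => [|[p q] r IHr] Pr.
    exists 0; first exact: ideal0 idP.
    by rewrite big_nil mul0r subr0; apply: integer_span0.
  have [|b Pb span_b] := IHr.
    by move=> pq rpq; apply: Pr; rewrite inE rpq orbT.
  have [/= Pp Pq] := Pr (p, q) (mem_head _ _).
  have [c Oc span_c] := gen_f q (prod_set_ideal idP (fun y Oy => Oy) Pq).
  exists (b + p * c); first by apply: (idealD idP) => //; apply: (idealMr idP).
  rewrite big_cons /=.
  rewrite (_ : _ - _ = (\sum_(j <- r) f * (j.1 * j.2) - b * a)
                       + p * (f * q - c * a)); last by ring.
  apply: integer_spanD => //; apply: integer_spanM => //.
  exact: ideal_integers idP _ Pp.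
have Ob := ideal_integers idP Pb.
(* Since b is in P, [e'] is outside P, and [e' * a] lies in the span of the remaining generators. *)
pose e' := f * e - b.
have Oe' : O e' by apply: integersB => //; apply: integersM.
have span_a : integer_span s (e' * a) by rewrite /e' mulrBl -mulrA.
exists (f * e'); split; first exact: integersM.
  apply: (prime_ideal_notM prP) => // Pe'.
  apply: (prime_ideal_notM prP Of Oe nPf nPe).
  by rewrite -[f * e](subrK b); apply: (idealD idP).
move=> v Pv; have [c Oc span_c] := gen_f v Pv.
rewrite (_ : _ * v = c * (e' * a) + e' * (f * v - c * a)); last by ring.
by apply: integer_spanD; apply: integer_spanM.
Qed.
End Span.
(** * Inertia and ramification *)

Section Inertia.
Variables (L : splittingFieldType rat) (K E : {subfield L}).
Hypothesis galKE : galois K E.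
Local Notation O := (ring_of_integers E).
Local Notation G := 'Gal(E / K)%g.

(* f u is the product over s in l of u c_s - s c_s, where s c_s <> c_s mod P. *)
Lemma trace_separation (P : L -> Prop) (l : seq (gal_of E)) :
    is_prime_ideal E P ->
    (forall s, s \in l -> exists2 c, O c & ~ P (s c - c)) ->
  exists r : seq (L * L), let f (s : gal_of E) := \sum_(ab <- r) ab.1 * s ab.2 in
    [/\ forall ab, ab \in r -> O ab.1 /\ O ab.2, ~ P (f 1%g)
      & forall s, s \in l -> f s = 0].
Proof.
move=> prP; have idP : is_ideal E P by case: prP.
elim: l => [|s l IHl] sep_l /=.
  exists [:: (1, 1)]; split=> // [ab|]; last first.
    by rewrite big_seq1 gal_id mulr1; exact: prime_ideal1 prP.
  by rewrite inE => /eqP ->; split; exact: integers1.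
have [|r [Or nPr r0]] := IHl.
  by move=> u lu; apply: sep_l; rewrite inE lu orbT.
have [c Oc nPc] := sep_l s (mem_head _ _).
exists ([seq (ab.1, ab.2 * c) | ab <- r] ++ [seq (- (ab.1 * s c), ab.2) | ab <- r]).
have fE (u : gal_of E) :
    \sum_(ab <- [seq (ab.1, ab.2 * c) | ab <- r]
               ++ [seq (- (ab.1 * s c), ab.2) | ab <- r]) ab.1 * u ab.2
    = (\sum_(ab <- r) ab.1 * u ab.2) * (u c - s c).
  rewrite big_cat !big_map /= mulrBr !mulr_suml -sumrB -big_split /=.
  by apply: eq_bigr => ab _; rewrite rmorphM /=; ring.
split.
- move=> ab; rewrite mem_cat => /orP[] /mapP[[a b] /Or[/= Oa Ob] ->] /=.
    by split=> //; apply: integersM.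
  by split=> //; apply/integersN/integersM => //; apply: integers_gal.
- rewrite fE gal_id; apply: (prime_ideal_notM prP) => //.
  + by apply: integers_sum => ab /Or[Oa Ob]; rewrite gal_id; apply: integersM.
  + by apply: integersB => //; apply: integers_gal.
  + by rewrite -opprB => /(idealN idP); rewrite opprK.
move=> u; rewrite fE inE => /predU1P[->|/r0 ->]; last by rewrite mul0r.
by rewrite subrr mulr0.
Qed.

(** A substitute for the Chinese remainder theorem: z is a product of one factor w for each s. If
    s^-1 P is not inside P, any w in s^-1 P outside P will do; if it is, finiteness of the order of
    s gives equality, and w = 1 will do. *)
Lemma prime_ideal_conjugates (P : L -> Prop) (l : seq (gal_of E)) :
    is_prime_ideal E P ->
  exists z, [/\ O z, ~ P z & forall s x, s \in l -> P x -> P (s (z * x))].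
Proof.
move=> prP; have idP : is_ideal E P by case: prP.
elim: l => [|s l [z [Oz nPz Pz]]].
  by exists 1; split=> //; [exact: integers1 | exact: prime_ideal1 prP].
have [w [Ow nPw Pw]] : exists w, [/\ O w, ~ P w & forall x, P x -> P (s (w * x))].
  have [[w [Ow nPw Psw]]|no_w] := classic (exists w, [/\ O w, ~ P w & P (s w)]).
    exists w; split=> // x Px; rewrite rmorphM; apply: (idealMr idP) => //.
    by apply/integers_gal/(ideal_integers idP).
  have sV x : O x -> P (s x) -> P x.
    by move=> Ox Psx; apply: NNPP => nPx; apply: no_w; exists x.
  exists 1; split; [exact: integers1 | exact: prime_ideal1 prP |].
  move=> x Px; rewrite mul1r; have Ox := ideal_integers idP Px.
  (* Start from s^n x = x with n the order of s, and strip one s at a time by [sV] until s x is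
     reached. *)
  have : P ((s ^+ #[s].-1.+1)%g x).
    by rewrite prednK ?order_gt0 // expg_order gal_id //; case: Ox.
  elim: (#[s]%g.-1) => [|n IHn]; first by rewrite expg1.
  rewrite expgSr galM; last by case: Ox.
  by move/sV => /(_ (integers_gal _ Ox)).
exists (z * w); split; first exact: integersM.
  exact: (prime_ideal_notM prP).
move=> u x; rewrite inE => /predU1P[->|lu] Px.
  rewrite -mulrA rmorphM; apply: (idealMl idP); last exact: Pw.
  exact: integers_gal.
by rewrite -mulrA; apply: Pz => //; apply: (idealMl idP).
Qed.

(* With f vanishing outside 1 and d = f 1, any q whose conjugates all lie in P
   satisfies d q = \sum_i a_i Tr(b_i q), hence lies in pE up to the factor d
   prime to P. *)
Lemma unramified_of_trivial_inertia (P : L -> Prop) (x : L) :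
    is_prime_ideal E P -> P x -> x != 0 ->
    (forall s, s \in G -> s != 1%g -> exists2 c, O c & ~ P (s c - c)) ->
  is_ramification_index K E P 1.
Proof.
move=> prP Px x0 inertia; have idP : is_ideal E P by case: prP.
split=> [a [r Pr ->] | sub_sq].
  by exists r => // ab /Pr[[_ Pab]].
have [a Pa not_sq] := prime_ideal_not_idempotent prP Px x0.
have [|r [Or nPr r0]] := @trace_separation P (enum [pred s in G | s != 1%g]) prP.
  by move=> s; rewrite mem_enum => /andP[sG s1]; apply: inertia.
have [z [Oz nPz Pz]] := prime_ideal_conjugates (enum G) prP.
set d := \sum_(ab <- r) _ in nPr.
have Od : O d.
  by apply: integers_sum => ab /Or[Oa Ob]; rewrite gal_id; apply: integersM.
(* If P^2 contained pE, it would contain d z a, against the choice of a, since d z is outside P. *)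
apply: (not_sq (d * z)); first exact: integersM.
  exact: (prime_ideal_notM prP).
apply: sub_sq; rewrite -mulrA; set q := z * a.
have Pq s : s \in G -> P (s q) by move=> sG; apply: Pz => //; rewrite mem_enum.
have Oq : O q by apply: integersM => //; exact: ideal_integers idP _ Pa.
have -> : d * q = \sum_(ab <- r) galTrace K E (ab.2 * q) * ab.1.
  transitivity (\sum_(s in G) (\sum_(ab <- r) ab.1 * s ab.2) * s q).
    rewrite (bigD1 1%g) ?group1 //= gal_id -/d big1 ?addr0 // => s sG.
    by rewrite r0 ?mul0r // mem_enum.
  under eq_bigr do rewrite mulr_suml.
  rewrite exchange_big /=; apply: eq_bigr => ab _.
  rewrite /galTrace mulr_suml; apply: eq_bigr => s _.
  by rewrite [s (_ * q)]rmorphM /=; ring.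
exists [seq (galTrace K E (ab.2 * q), ab.1) | ab <- r]; last by rewrite big_map.
move=> _ /mapP[[b c] /Or[/= Ob Oc] ->] /=; split=> //; split.
  by apply: mem_galTrace => //; case: (integersM Oc Oq).
apply: (ideal_sum idP) => s _ sG; rewrite [s (_ * q)]rmorphM; apply: (idealMl idP).
  exact: integers_gal.
exact: Pq.
Qed.
End Inertia.

(** * Characteristic polynomials modulo a prime with full inertia *)

Section InertiaPolynomials.
Variables (L : splittingFieldType rat) (K E : {subfield L}) (P : L -> Prop).
Local Notation O := (ring_of_integers E).
Local Notation G := 'Gal(E / K)%g.
Hypothesis prP : is_prime_ideal E P.

Let idP : is_ideal E P. Proof. by case: prP. Qed.

Lemma coef_prod_XsubC_congr (w : L) (r : seq L) :
    O w -> (forall a, a \in r -> O a /\ P (a - w)) ->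
  forall k, P ((\prod_(a <- r) ('X - a%:P) - ('X - w%:P) ^+ size r)`_k).
Proof.
move=> Ow Pr.
have OX n k : O ((('X - w%:P) ^+ n)`_k).
  elim: n k => [|n IHn] k.
    by rewrite coef1; exact: integers_nat.
  rewrite exprS mulrBl coefB coefXM coefCM.
  apply: integersB; last exact: integersM.
  by case: ifP => _; [exact: integers0 | exact: IHn].
elim: r Pr => [|a r IHr] Pr k.
  by rewrite big_nil subrr coef0; exact: ideal0 idP.
have [Oa Paw] := Pr a (mem_head _ _).
have {}IHr j := IHr (fun b rb => Pr b (mem_behead (s := a :: r) rb)) j.
set A := \prod_(b <- r) _ in IHr; set B := _ ^+ size r in IHr.
have -> : \prod_(b <- a :: r) ('X - b%:P) - ('X - w%:P) ^+ size (a :: r)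
          = 'X * (A - B) - a%:P * (A - B) - (a - w)%:P * B.
  by rewrite big_cons exprS -/A -/B; ring.
rewrite !coefB coefXM !coefCM; apply: (idealB idP); last first.
  by apply: (idealMr idP) => //; apply: OX.
apply: (idealB idP); last by apply: (idealMl idP).
by case: ifP => _; [exact: ideal0 idP | exact: IHr].
Qed.

Lemma gal_congr_cycle (s u : gal_of E) :
    (forall c, O c -> P (s c - c)) -> u \in <[s]>%g ->
  forall c, O c -> P (u c - c).
Proof.
move=> Ps /cycleP[n ->{u}]; elim: n => [|n IHn] c Oc.
  by rewrite expg0 gal_id subrr; apply: ideal0 idP.
have [Ec _] := Oc; rewrite expgS galM //.
rewrite (_ : _ - c = ((s ^+ n)%g (s c) - s c) + (s c - c)); last by ring.
by apply: (idealD idP); [apply/IHn/integers_gal | apply: Ps].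
Qed.

Lemma prod_XsubC_gal (p : {poly L}) (w : L) :
    (K <= E)%VS -> p \is a polyOver K -> p \is monic ->
    size p = (#|G|).+1 -> root p w -> w \in E ->
    {in G &, injective (fun u : gal_of E => u w)} ->
  p = \prod_(a <- [seq (u : gal_of E) w | u in G]) ('X - a%:P).
Proof.
move=> sKE Kp mon_p size_p pw0 Ew inj_w.
rewrite [LHS](all_roots_prod_XsubC (rs := [seq (u : gal_of E) w | u in G])).
- by rewrite (monicP mon_p) scale1r.
- by rewrite size_p size_image.
- apply/allP=> _ /imageP[u uG ->].
  by rewrite -(fixedPoly_gal sKE uG Kp); apply: rmorph_root.
- rewrite uniq_rootsE map_inj_in_uniq ?enum_uniq // => u v.
  by rewrite !mem_enum; apply: inj_w.
Qed.

(** A nontrivial s generates the group of order 5, so all conjugates of w are congruent to w mod P,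
    and the coefficients of X^4, X^3 and X are compared with those of (X - w)^5. *)
Lemma quintic_inertia_coefs (s : gal_of E) (w a0 a1 a2 a3 a4 : L) :
    (K <= E)%VS -> #|G| = 5%N -> s \in G -> s != 1%g ->
    (forall c, O c -> P (s c - c)) ->
    (forall a, a \in [:: a0; a1; a2; a3; a4] -> ring_of_integers K a) ->
    w ^+ 5 + a4 * w ^+ 4 + a3 * w ^+ 3 + a2 * w ^+ 2 + a1 * w + a0 = 0 ->
    w \in E -> {in G &, injective (fun u : gal_of E => u w)} ->
  [/\ O w, P (a4 + 5 * w), P (a3 - 10 * w ^+ 2) & P (a1 - 5 * w ^+ 4)].
Proof.
move=> sKE oG sG s1 Ps Oa w0 Ew inj_w.
pose p := Poly [:: a0; a1; a2; a3; a4; 1].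
have pE : p = [:: a0; a1; a2; a3; a4; 1] :> seq L.
  by rewrite (@PolyK _ 0) //= oner_neq0.
have Op i : ring_of_integers K p`_i.
  by rewrite pE; case: i => [|[|[|[|[|[|i]]]]]] /=;
    rewrite ?nth_nil; by [exact: integers1 | exact: integers0
                         | apply: Oa; rewrite !inE eqxx ?orbT].
have mon_p : p \is monic by rewrite monicE lead_coefE pE.
have pw0 : root p w by apply/rootP; rewrite horner_Poly /= -[RHS]w0; ring.
have Ow : O w.
  apply: integers_root mon_p _ Ew pw0 => i.
  by case: (Op i) => Kpi ?; split; first exact: (subvP sKE).
have cycG : G = <[s]>%g.
  by apply: nt_gen_prime; rewrite ?oG // !inE s1 sG.
have pprod : p = \prod_(a <- [seq (u : gal_of E) w | u in G]) ('X - a%:P).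
  apply: prod_XsubC_gal => //; last by rewrite pE oG.
  by apply/polyOverP=> i; case: (Op i).
have Pcoef k : P (p`_k - (('X - w%:P) ^+ 5)`_k).
  rewrite -coefB pprod.
  have <- : size [seq (u : gal_of E) w | u in G] = 5%N by rewrite size_image.
  apply: coef_prod_XsubC_congr => // _ /imageP[u uG ->].
  split; first exact: integers_gal.
  by apply: (gal_congr_cycle Ps); rewrite -?cycG.
have XE : ('X - w%:P) ^+ 5 = 'X^5 - (5 * w)%:P * 'X^4 + (10 * w ^+ 2)%:P * 'X^3
    - (10 * w ^+ 3)%:P * 'X^2 + (5 * w ^+ 4)%:P * 'X - (w ^+ 5)%:P by ring.
have := (Pcoef 4, Pcoef 3, Pcoef 1); rewrite XE pE !coefE /=.
rewrite !(mulr0, mulr1, addr0, add0r, subr0, sub0r, oppr0, opprK).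
by case=> [[]].
Qed.
End InertiaPolynomials.
(** * The quartic and the quintic *)

Lemma eqz_modP (m n d : int) :
  (m = n %[mod d])%Z -> exists k, m = n + d * k.
Proof.
move/eqP; rewrite eqz_mod_dvd => /dvdzP[k mn]; exists k.
by rewrite mulrC -mn addrC subrK.
Qed.

Lemma ndvd5_eq (m r n : int) : n = 5 * m + r -> ~~ (5 %| r)%Z -> ~~ (5 %| n)%Z.
Proof. by move=> ->; rewrite rpredDl ?dvdz_mulr. Qed.

Ltac mem_field :=
  repeat lazymatch goal with
  | |- is_true (in_mem (_ %:R) _) => exact: rpred_nat
  | |- is_true (in_mem (_ %:~R) _) => exact: rpred_int
  | |- is_true (in_mem 0 _) => exact: mem0v
  | |- is_true (in_mem 1 _) => exact: rpred1
  | |- is_true (in_mem (_ - _) _) => apply: rpredB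
  | |- is_true (in_mem (_ + _) _) => apply: rpredD
  | |- is_true (in_mem (- _) _) => rewrite rpredN
  | |- is_true (in_mem (_ / _) _) => apply: rpred_div
  | |- is_true (in_mem (_ * _) _) => apply: rpredM
  | |- is_true (in_mem (_ ^+ _) _) => apply: rpredX
  | |- _ => first [assumption | exact: memv_adjoin]
  end.

Lemma quarticPE t (T : rat := t%:~R) :
  quarticP t = Poly [:: 5 * (T ^+ 2 + 16) * (T - 2) ^+ 2; 0;
                        5 * (T ^+ 2 + 16); 0; 1].
Proof.
apply/polyP=> i; rewrite coef_Poly /quarticP !coefE.
by case: i => [|[|[|[|[|i]]]]] /=;
  rewrite ?nth_nil ?(mulr0, mulr1, addr0, add0r).
Qed.

Lemma quinticPE t (T : rat := t%:~R) :
  quinticP t = Poly [:: - T ^+ 2 + T - 16; - 15; - (5 * T); 10; 0; 1].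
Proof.
apply/polyP=> i; rewrite coef_Poly /quinticP !coefE.
by case: i => [|[|[|[|[|[|i]]]]]] /=;
  rewrite ?nth_nil ?(mulr0, mulr1, addr0, add0r, subr0).
Qed.

Lemma size_quarticP t : size (quarticP t) = 5%N.
Proof. by rewrite quarticPE (@PolyK _ 0) //= oner_neq0. Qed.

Lemma size_quinticP t : size (quinticP t) = 6%N.
Proof. by rewrite quinticPE (@PolyK _ 0) //= oner_neq0. Qed.

(** These values would make the denominators t - 2 and t + 8 vanish. There the quartic is X^4 + 100
    X^2, respectively (X^2 + 200)^2. *)
Lemma irreducible_quarticP_neq t :
  irreducible_poly (quarticP t) -> t != 2 /\ t != - 8.
Proof.
move=> irr_q; have no_factor (q r : {poly rat}) :
    (1 < size q < 5)%N -> quarticP t <> r * q.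
  case/andP=> q1 q5 qE.
  have /eqp_size qp : q %= quarticP t.
    by apply: irr_q.2; [rewrite neq_ltn q1 orbT | rewrite qE dvdp_mull].
  by rewrite qp size_quarticP in q5.
split; apply/eqP=> tE.
  case: (no_factor 'X ('X^3 + 100%:P * 'X)); first by rewrite size_polyX.
  by rewrite tE /quarticP; ring.
case: (no_factor ('X^2 + 200%:P) ('X^2 + 200%:P)).
  by rewrite size_polyDl size_polyXn // (leq_ltn_trans (size_polyC_leq1 _)).
by rewrite tE /quarticP; ring.
Qed.

(** * The quartic field K *)

Section Quartic.
Variables (L : splittingFieldType rat) (t : int) (y : L).
Hypothesis irr_q : irreducible_poly (quarticP t).
Hypothesis root_y : root (map_poly (in_alg L) (quarticP t)) y.
Local Notation T := (t%:~R : L).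

Lemma map_quarticPE :
  map_poly (in_alg L) (quarticP t)
  = Poly [:: 5 * (T ^+ 2 + 16) * (T - 2) ^+ 2; 0; 5 * (T ^+ 2 + 16); 0; 1].
Proof.
rewrite quarticPE map_Poly_id0 ?rmorph0 // !map_cons.
by rewrite !(rmorph_nat, rmorph_int, rmorphXn, rmorphM, rmorphN, rmorphD,
            rmorph0, rmorph1).
Qed.

Lemma map_quinticPE :
  map_poly (in_alg L) (quinticP t)
  = Poly [:: - T ^+ 2 + T - 16; - 15; - (5 * T); 10; 0; 1].
Proof.
rewrite quinticPE map_Poly_id0 ?rmorph0 // !map_cons.
by rewrite !(rmorph_nat, rmorph_int, rmorphXn, rmorphM, rmorphN, rmorphD,
            rmorph0, rmorph1).
Qed.

Lemma monic_map_quartic : map_poly (in_alg L) (quarticP t) \is monic.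
Proof.
by rewrite monicE lead_coef_map /= lead_coefE size_quarticP quarticPE
           coef_Poly /= scale1r.
Qed.

Lemma quartic_root_eq :
  y ^+ 4 + 5 * (T ^+ 2 + 16) * y ^+ 2 + 5 * (T ^+ 2 + 16) * (T - 2) ^+ 2 = 0.
Proof.
by move/rootP: root_y; rewrite map_quarticPE horner_Poly /= => <-; ring.
Qed.

Let nt2 : T - 2 != 0.
Proof.
rewrite -(rmorphB (intr : int -> L) t 2) intrL_eq0 subr_eq0.
by case: (irreducible_quarticP_neq irr_q).
Qed.

Let nt8 : T + 8 != 0.
Proof.
rewrite -(rmorphD (intr : int -> L) t 8) intrL_eq0 addr_eq0.
by case: (irreducible_quarticP_neq irr_q).
Qed.

Let nA : T ^+ 2 + 16 != 0.
Proof.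
rewrite -(rmorphXn (intr : int -> L)) -(rmorphD (intr : int -> L) (t ^+ 2) 16).
rewrite intrL_eq0; nia.
Qed.

Lemma quartic_root_neq0 : y != 0.
Proof.
apply/eqP=> y0; have := quartic_root_eq; apply/eqP.
by rewrite y0 !expr0n mulr0 !add0r !mulf_neq0 ?expf_neq0 ?natrL_neq0.
Qed.

(** As a quadratic in y^2, the quartic has discriminant 5 A (t + 8)^2 with A = t^2 + 16; this is the
    resulting square root of 5 A. *)
Definition quartic_sqrt : L := (2 * y ^+ 2 + 5 * (T ^+ 2 + 16)) / (T + 8).
Local Notation d := quartic_sqrt.

Lemma quartic_sqrt_sqr : d ^+ 2 = 5 * (T ^+ 2 + 16).
Proof.
rewrite /d exprMn exprVn; apply: (canLR (mulfK (expf_neq0 2 nt8))).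
apply/eqP; rewrite -subr_eq0; apply/eqP.
rewrite -[RHS](mulr0 4) -quartic_root_eq; ring.
Qed.

Lemma quartic_sqrt_lin : 2 * y ^+ 2 = (T + 8) * d - 5 * (T ^+ 2 + 16).
Proof. by rewrite /d [(T + 8) * _]mulrC divfK // addrK. Qed.

Lemma quartic_sqrt_adjoin : d \in <<1; y>>%VS.
Proof.
have Ky : y \in <<1; y>>%VS by apply: memv_adjoin.
by rewrite /quartic_sqrt; mem_field.
Qed.

Lemma adjoin_degree_quartic : adjoin_degree 1 y = 4%N.
Proof. by rewrite (adjoin_degree_irreducible irr_q root_y) size_quarticP. Qed.

Lemma quartic_cyclic : cyclic_extension 1%AS <<1; y>>%AS.
Proof.
have y0 := quartic_root_neq0; have d2 := quartic_sqrt_sqr.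
have Ky : y \in <<1; y>>%VS by apply: memv_adjoin.
have y2 := quartic_sqrt_lin.
have d0 : d != 0.
  have : d ^+ 2 != 0 by rewrite d2 mulf_neq0 ?natrL_neq0.
  by rewrite expf_eq0.
pose z := (T - 2) * d / y.
have Kz : z \in <<1; y>>%VS.
  by have Kd := quartic_sqrt_adjoin; rewrite /z; mem_field.
(* z^2 is the other root of the quadratic satisfied by y^2; exchanging the two changes the sign of
   d. *)
have zy2 : z ^+ 2 = - (y ^+ 2 + 5 * (T ^+ 2 + 16)).
  rewrite /z exprMn exprVn; apply: (canLR (mulfK (expf_neq0 2 y0))).
  rewrite exprMn d2; apply/eqP; rewrite -subr_eq0; apply/eqP.
  by rewrite -quartic_root_eq; ring.
have root_z : root (map_poly (in_alg L) (quarticP t)) z.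
  apply/rootP; rewrite map_quarticPE horner_Poly /=.
  transitivity (z ^+ 2 * (z ^+ 2 + 5 * (T ^+ 2 + 16))
                + 5 * (T ^+ 2 + 16) * (T - 2) ^+ 2).
    by ring.
  by rewrite zy2 -[RHS]quartic_root_eq; ring.
have minE : minPoly 1 y = map_poly (in_alg L) (quarticP t).
  apply/eqP; rewrite -eqp_monic ?monic_minPoly ?monic_map_quartic //.
  rewrite -dvdp_size_eqp ?minPoly_dvdp ?alg_polyOver //.
  by rewrite size_minPoly adjoin_degree_quartic size_map_poly size_quarticP.
rewrite -minE in root_z.
have [s galKs sy] := gal_adjoin_root Kz root_z.
have fix_s := fixed_gal (sub1v _) galKs.
have sd : s d = - d.
  rewrite /quartic_sqrt fmorph_div.
  rewrite !(rmorph_nat, rmorph_int, rmorphXn, rmorphM, rmorphD) /= sy zy2.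
  rewrite -mulNr; congr (_ / _); ring: y2.
have sz : s z = - y.
  rewrite /z fmorph_div rmorphM rmorphB rmorph_nat rmorph_int /= sy sd.
  by rewrite /z; field; rewrite y0 d0 nt2.
have s2y : (s ^+ 2)%g y = - y by rewrite expgS expg1 galM // sy sz.
have s4 : (s ^+ 4 = 1)%g.
  apply/eqP; rewrite (gal_adjoin_eq (K := 1%AS)) ?groupX ?group1 // gal_id.
  by rewrite (expgM s 2 2) expgS expg1 galM // s2y rmorphN /= s2y opprK.
have os : #[s]%g = 4%N.
  have s2 : (s ^+ 2 != 1)%g.
    apply/eqP=> s2; move/eqP: s2y; rewrite s2 gal_id -subr_eq0 opprK -mulr2n.
    by rewrite -mulr_natl mulf_eq0 (negPf y0) (negPf (natrL_neq0 L (n := 2) _)).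
  have := s4; move/eqP; rewrite -order_dvdn => o4.
  move: s2; rewrite -order_dvdn => o2.
  move: o4 o2 (dvdn_leq (isT : 0 < 4)%N o4).
  by case: #[s]%g => [|[|[|[|[|]]]]].
have [] := galois_cyclic_of_order (sub1v _) galKs.
  by rewrite os -adjoin_degreeE adjoin_degree_quartic.
by move=> galK galE; split=> //; rewrite galE cycle_cyclic.
Qed.

(** * The splitting field E of the quintic over K *)

Section Quintic.
Variable E : {subfield L}.
Hypothesis irr_p : irreducible_poly (quinticP t).
Hypothesis split_E :
  splittingFieldFor <<1; y>>%AS (map_poly (in_alg L) (quinticP t)) E.
Local Notation K := <<1; y>>%AS.
Local Notation p := (map_poly (in_alg L) (quinticP t)).

Lemma monic_map_quintic : p \is monic.
Proof.
by rewrite monicE lead_coef_map /= lead_coefE size_quinticP quinticPE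
           coef_Poly /= scale1r.
Qed.

(** 5 = [Q(x) : Q] divides [K(x) : Q] = 4 [K(x) : K], hence [K(x) : K], which is at most 5. *)
Lemma dim_adjoin_quintic x : root p x -> adjoin_degree K x = 5%N.
Proof.
move=> px0; have := dim_Fadjoin K x.
rewrite (dim_Fadjoin 1 y) adjoin_degree_quartic dimv1 muln1 => dimKx.
have dimQx : \dim <<1; x>> = 5%N.
  rewrite dim_Fadjoin (adjoin_degree_irreducible irr_p px0).
  by rewrite size_quinticP dimv1.
have : (5 %| \dim <<K; x>>)%N.
  rewrite -dimQx field_dimS // sub_adjoin1v; exact: memv_adjoin.
rewrite dimKx Gauss_dvdl // => n5.
apply/eqP; rewrite eqn_leq (dvdn_leq _ n5) // andbT.
have := minPoly_dvdp (alg_polyOver K _) px0.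
move/(dvdp_leq (monic_neq0 monic_map_quintic)).
by rewrite size_minPoly size_map_poly size_quinticP.
Qed.

Lemma minPoly_quintic x : root p x -> minPoly K x = p.
Proof.
move=> px0; apply/eqP.
rewrite -eqp_monic ?monic_minPoly ?monic_map_quintic //.
rewrite -dvdp_size_eqp ?minPoly_dvdp ?alg_polyOver //.
by rewrite size_minPoly (dim_adjoin_quintic px0) size_map_poly size_quinticP.
Qed.

Lemma quintic_root_eq x : root p x ->
  x ^+ 5 + 10 * x ^+ 3 - 5 * T * x ^+ 2 - 15 * x + (- T ^+ 2 + T - 16) = 0.
Proof. by move/rootP; rewrite map_quinticPE horner_Poly /= => <-; ring. Qed.

(** This is p'(x) / 5, the denominator in the second root: a polynomial in x of degree less than
    [K(x) : K]. *)
Lemma quintic_deriv_neq0 x :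
  root p x -> x ^+ 4 + 6 * x ^+ 2 - 2 * T * x - 3 != 0.
Proof.
move=> px0; apply/eqP=> dx0.
pose q : {poly L} := Poly [:: - 3; - (2 * T); 6; 0; 1].
have sq : size q = 5%N by rewrite (@PolyK _ 0) //= oner_neq0.
have : root q x.
  by apply/rootP; rewrite horner_Poly /= -[RHS]dx0; ring.
rewrite (root_small_adjoin_poly (K := K)).
- by rewrite -size_poly_eq0 sq.
- apply/polyOverP=> i; rewrite coef_Poly.
  by case: i => [|[|[|[|[|i]]]]] /=; rewrite ?nth_nil; mem_field.
- by rewrite sq (dim_adjoin_quintic px0).
Qed.

Lemma quintic_galois :
  exists x, [/\ root p x, E = <<K; x>>%AS, galois K E & #|'Gal(E / K)%g| = 5%N].
Proof.
have [rs p_rs E_rs] := split_E.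
have [x rs_x] : exists x, x \in rs.
  have := eqp_size p_rs; rewrite size_map_poly size_quinticP size_prod_XsubC.
  by case: (rs) => [|x rs'] // _; exists x; rewrite mem_head.
have px0 : root p x by rewrite (eqp_root p_rs) root_prod_XsubC.
have [z [Kz zx pz]] : exists z, [/\ z \in <<K; x>>%VS, z != x & root p z].
  have nD := quintic_deriv_neq0 px0.
  have n2 : 2 != 0 :> L by rewrite natrL_neq0.
  have n5 : 5 != 0 :> L by rewrite natrL_neq0.
  have [] := quintic_second_root n2 n5 nt2 nD (quintic_root_eq px0)
                                 quartic_sqrt_sqr quartic_sqrt_lin.
  set z := (_ / _ - _) => zx pz; exists z; split=> //; last first.
    by apply/rootP; rewrite map_quinticPE horner_Poly /= -[RHS]pz; ring.
  have Kx := memv_adjoin K x.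
  have Ky : y \in <<K; x>>%VS by apply: subvP_adjoin; apply: memv_adjoin.
  have Kd : quartic_sqrt \in <<K; x>>%VS.
    by apply: subvP_adjoin; apply: quartic_sqrt_adjoin.
  by rewrite /z; mem_field.
have [s galKs sx] : exists2 s : gal_of <<K; x>>,
    s \in 'Gal(<<K; x>> / K)%g & s x = z.
  by apply: gal_adjoin_root => //; rewrite minPoly_quintic.
have dKx : \dim_K <<K; x>> = 5%N.
  by rewrite -adjoin_degreeE (dim_adjoin_quintic px0).
(* The order of s divides the prime 5, and s moves x. *)
have os : #[s]%g = 5%N.
  have s1 : s != 1%g by apply: contraNneq zx => s1; rewrite -sx s1 gal_id.
  apply/prime_nt_dvdP => //; first by rewrite order_eq1.
  by rewrite -dKx; apply: order_gal_dvdn; rewrite ?subv_adjoin.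
have [galK galE] : galois K <<K; x>>%AS /\ 'Gal(<<K; x>>%AS / K)%g = <[s]>%g.
  by apply: galois_cyclic_of_order => //; [exact: subv_adjoin | rewrite os dKx].
(* K(x) is normal over K, so it contains the other roots of p. *)
exists x; have EE : E = <<K; x>>%AS.
  apply: val_inj; apply/eqP; rewrite eqEsubv -[val E]E_rs; apply/andP; split.
    apply/Fadjoin_seqP; split=> [|r rs_r]; first exact: subv_adjoin.
    have : root p r by rewrite (eqp_root p_rs) root_prod_XsubC.
    have [l [_ _]] := galois_factors (subv_adjoin K x) galK x (memv_adjoin K x).
    rewrite (minPoly_quintic px0) => ->; rewrite root_prod_XsubC.
    by case/mapP=> g _ ->; apply: memv_gal; apply: memv_adjoin.
  apply/FadjoinP; split; first exact: subv_adjoin_seq.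
  by rewrite seqv_sub_adjoin.
by rewrite EE; split=> //; rewrite galE -[#|_|]/(#[s]%g).
Qed.

Ltac mem_integers :=
  repeat lazymatch goal with
  | |- ring_of_integers _ (_ %:R) => exact: integers_nat
  | |- ring_of_integers _ (_ %:~R) => exact: integers_int
  | |- ring_of_integers _ (_ + _) => apply: integersD
  | |- ring_of_integers _ (- _) => apply: integersN
  | |- ring_of_integers _ (_ * _) => apply: integersM
  | |- ring_of_integers _ (_ ^+ _) => apply: integersX
  | |- ring_of_integers _ 0 => exact: integers0
  | |- ring_of_integers _ 1 => exact: integers1
  | |- _ => assumption
  end.

Lemma integers_quartic_root : ring_of_integers K y.
Proof.
apply: integers_root monic_map_quartic _ (memv_adjoin _ _) root_y => i.
rewrite map_quarticPE coef_Poly.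
by case: i => [|[|[|[|[|i]]]]] /=; rewrite ?nth_nil; mem_integers.
Qed.

(** * Inertia over K at a finite place *)

Section FinitePlace.
Variables (P : L -> Prop) (s : gal_of E) (x : L).
Hypotheses (prP : is_prime_ideal E P) (px0 : root p x) (E_x : E = <<K; x>>%AS).
Hypothesis order_G : #|'Gal(E / K)%g| = 5%N.
Hypotheses (galK_s : s \in 'Gal(E / K)%g) (s1 : s != 1%g).
Hypothesis Ps : forall c, ring_of_integers E c -> P (s c - c).
Local Notation A := (T ^+ 2 + 16).

Let idP : is_ideal E P. Proof. by case: prP. Qed.
Let sKE : (K <= E)%VS. Proof. by rewrite E_x; exact: subv_adjoin. Qed.
Let Oy : ring_of_integers K y := integers_quartic_root.
Let Ky : y \in K. Proof. exact: memv_adjoin. Qed.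

Lemma integers_subfield c : ring_of_integers K c -> ring_of_integers E c.
Proof. by case=> Kc ?; split; first exact: (subvP sKE). Qed.

(** As k is nonzero, w still generates E over K, so its conjugates are distinct. *)
Lemma affine_inertia_coefs (k c a0 a1 a2 a3 a4 : L) :
    k \in K -> k != 0 -> c \in K ->
    (forall a, a \in [:: a0; a1; a2; a3; a4] -> ring_of_integers K a) ->
    let w := k * (x - c) in
    w ^+ 5 + a4 * w ^+ 4 + a3 * w ^+ 3 + a2 * w ^+ 2 + a1 * w + a0 = 0 ->
  [/\ ring_of_integers E w, P (a4 + 5 * w), P (a3 - 10 * w ^+ 2)
    & P (a1 - 5 * w ^+ 4)].
Proof.
move=> Kk k0 Kc Oa w w0.
have Ex : x \in E by rewrite E_x; exact: memv_adjoin.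
apply: (quintic_inertia_coefs prP sKE order_G galK_s s1 Ps Oa w0).
  by rewrite rpredM ?rpredB // (subvP sKE).
move=> u v uG vG; rewrite /w !rmorphM !rmorphB /=.
rewrite (fixed_gal sKE uG Kk) (fixed_gal sKE vG Kk).
rewrite (fixed_gal sKE uG Kc) (fixed_gal sKE vG Kc).
move/(mulfI k0)/addIr; move: u v uG vG; rewrite E_x => u v uG vG uv.
by apply/eqP; rewrite (gal_adjoin_eq uG vG) uv.
Qed.

(* In any other characteristic, p = (X - x)^5 mod P forces x = 0 mod P, then
   10 = - 15 = 0. *)
Lemma inertia_prime5 : P 5.
Proof.
have Kints (n : int) : ring_of_integers K (n%:~R : L) by apply: integers_int.
have [] := @affine_inertia_coefs 1 0 (- T ^+ 2 + T - 16) (- 15) (- (5 * T)) 10 0.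
- exact: rpred1.
- exact: oner_neq0.
- exact: mem0v.
- move=> a; rewrite !inE => /or4P[/eqP->|/eqP->|/eqP->|/orP[]/eqP->];
    mem_integers.
- by rewrite -[RHS](quintic_root_eq px0); ring.
rewrite mul1r subr0 add0r => Ox P5x P3 P1.
have [//|Px] := prime_idealM prP (integers_nat E 5) Ox P5x.
have P10 : P 10.
  rewrite (_ : 10 = (10 - 10 * x ^+ 2) + 10 * x * x); last by ring.
  by apply: (idealD idP) => //; apply: (idealMl idP) => //; mem_integers.
rewrite (_ : 5 = - (- 15 - 5 * x ^+ 4) - 5 * x ^+ 3 * x - 10); last by ring.
apply: (idealB idP) => //; apply: (idealB idP); first exact: (idealN idP).
by apply: (idealMl idP) => //; mem_integers.
Qed.

Lemma ideal_quartic_root c :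
  ring_of_integers E c -> y ^+ 4 = 5 * c -> P y.
Proof.
move=> Oc y4; apply: (prime_idealX (n := 4) prP).
  exact: integers_subfield.
by rewrite y4; apply: (idealMr idP) => //; exact: inertia_prime5.
Qed.

Lemma inertia_int (n : int) : P n%:~R -> (5 %| n)%Z.
Proof. exact: (prime_ideal_dvdz (l := 5) prP isT inertia_prime5). Qed.

(* The Newton polygon of p(X + c) over Q_5 has slopes 1 (or more) and 1/4, and y
   has valuation 1/4. *)
Lemma inertia_totally_ramified (c e : int) :
    c ^+ 5 + 10 * c ^+ 3 - 5 * t * c ^+ 2 - 15 * c - t ^+ 2 + t - 16 = 25 * e ->
    ~~ (5 %| c ^+ 4 + 6 * c ^+ 2 - 2 * t * c - 3)%Z ->
    ~~ (5 %| (t ^+ 2 + 16) * (t - 2) ^+ 2)%Z ->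
  False.
Proof.
move=> pc nDc nA5; have P5 := inertia_prime5.
have y0 : y != 0 by apply: quartic_root_neq0.
have n5 : 5 != 0 :> L by rewrite natrL_neq0.
pose B := - (A * y ^+ 2 + A * (T - 2) ^+ 2).
have y4 : y ^+ 4 = 5 * B.
  by rewrite -[LHS]subr0 -quartic_root_eq /B; ring.
have OB : ring_of_integers K B by rewrite /B; mem_integers.
have Py : P y := ideal_quartic_root (integers_subfield OB) y4.
pose C : L := c%:~R; pose e' : L := e%:~R.
have OC : ring_of_integers K C by exact: integers_int.
have Oe : ring_of_integers K e' by exact: integers_int.
pose D := C ^+ 4 + 6 * C ^+ 2 - 2 * T * C - 3.
have pC : 25 * e' = C ^+ 5 + 10 * C ^+ 3 - 5 * T * C ^+ 2 - 15 * C
                    - T ^+ 2 + T - 16.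
  by rewrite /e' -(rmorph_nat intr 25) -rmorphM -pc /=; ring.
have BE : B = y ^+ 4 / 5 by rewrite y4 mulrC mulKf.
have eE : e' = (C ^+ 5 + 10 * C ^+ 3 - 5 * T * C ^+ 2 - 15 * C
                - T ^+ 2 + T - 16) / 25.
  by rewrite -pC mulrC mulKf // natrL_neq0.
(* The factor y^3 / 5 of valuation - 1/4 cancels the slope 1/4. The coefficient of X^j in p(X + C)
   gets multiplied by (y^3 / 5)^(5 - j), which y^4 = 5 B and p(C) = 25 e' make integral. *)
have [] := @affine_inertia_coefs (y ^+ 3 / 5) C (e' * y ^+ 3 * B ^+ 3)
  (D * B ^+ 3) ((2 * C ^+ 3 + 6 * C - T) * y * B ^+ 2)
  ((2 * C ^+ 2 + 2) * y ^+ 2 * B) (C * y ^+ 3).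
- by mem_field.
- by rewrite mulf_neq0 ?invr_eq0 ?expf_neq0.
- by case: OC.
- by move=> a; rewrite !inE => /or4P[/eqP->|/eqP->|/eqP->|/orP[]/eqP->];
    rewrite ?/D; mem_integers.
- rewrite /D BE eE -[RHS](mulr0 ((y ^+ 3 / 5) ^+ 5)) -(quintic_root_eq px0).
  by field; rewrite ?natrL_neq0.
move=> Ow _ _ P1.
have : P (D * B ^+ 3).
  rewrite -(subrK (5 * ((y ^+ 3 / 5) * (x - C)) ^+ 4) (D * B ^+ 3)).
  apply: (idealD idP) => //; apply: (idealMr idP) => //; exact: integersX.
(* D is excluded by [nDc]; B is - A (t - 2)^2 modulo y, excluded by [nA5]. *)
case/(prime_idealM prP).
- by apply: integers_subfield; rewrite /D; mem_integers.
- by apply: integers_subfield; mem_integers.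
- move=> PD; case/negP: nDc; apply: inertia_int; rewrite (_ : _%:~R = D) //.
  by rewrite /D /C; ring.
move/(prime_idealX prP (integers_subfield OB)) => PB.
case/negP: nA5; apply: inertia_int.
rewrite (_ : _%:~R = - B - A * y * y); last by rewrite /B; ring.
apply: (idealB idP); first exact: (idealN idP).
by apply: (idealMl idP) => //; apply: integers_subfield; mem_integers.
Qed.

(* The Newton polygon of p(X + 2) over Q_5 has slopes 1 (or more) and 3/4, and
   y has valuation 3/4. *)
Lemma inertia_t3_ramified (r : int) : t = 3 + 25 * r -> ~~ (5 %| 1 + r)%Z -> False.
Proof.
move=> tE nr; have P5 := inertia_prime5.
have y0 : y != 0 by apply: quartic_root_neq0.
have n5 : 5 != 0 :> L by rewrite natrL_neq0.
(* Here A = 25 A', whence y^4 = - 125 A' m. *)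
pose R : L := r%:~R; pose A' := 1 + 6 * R + 25 * R ^+ 2.
have TE : T = 3 + 25 * R by rewrite tE rmorphD rmorphM /= !rmorph_nat.
have OR : ring_of_integers K R by exact: integers_int.
have OT : ring_of_integers K T by exact: integers_int.
pose m := y ^+ 2 + (T - 2) ^+ 2.
have Om : ring_of_integers K m by rewrite /m; mem_integers.
have OA' : ring_of_integers K A' by rewrite /A'; mem_integers.
have y4 : y ^+ 4 = - (125 * A' * m).
  apply/eqP; rewrite -subr_eq0; apply/eqP; rewrite -[RHS]quartic_root_eq.
  by rewrite /A' /m TE; ring.
have Py : P y.
  have Oc : ring_of_integers K (- (25 * A' * m)) by mem_integers.
  by apply: (ideal_quartic_root (integers_subfield Oc)); rewrite y4; ring.
pose b := - (A' ^+ 3 * m ^+ 3).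
have Ob : ring_of_integers K b by rewrite /b; mem_integers.
(* [l] has valuation 9/4 - 2 = 1/4, so [l / 5] cancels the slope 3/4. *)
pose l := y ^+ 3 / 25.
have l4 : l ^+ 4 = 5 * b.
  transitivity (- (A' * m) ^+ 3 * 5 * (25 / 25) ^+ 4).
    by rewrite /l; transitivity ((y ^+ 4) ^+ 3 * 25^-1 ^+ 4); [|rewrite y4]; ring.
  by rewrite divff ?natrL_neq0 // /b; ring.
have Ol : ring_of_integers K l.
  apply: (@integers_root _ _ ('X^4 - (5 * b)%:P)).
  - by rewrite monicXnsubC.
  - move=> i; rewrite coefB coefXn coefC.
    by apply: integersB; [exact: integers_nat | case: ifP => _; mem_integers].
  - by rewrite /l; mem_field.
  - by apply/rootP; rewrite !hornerE l4 subrr.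
have [] := @affine_inertia_coefs (l / 5) 2 (- (R * (1 + R) * l * b))
  ((1 - 4 * R) * b) ((1 - R) * l ^+ 3) (2 * l ^+ 2) (2 * l).
- by case: Ol => Kl _; mem_field.
- by rewrite /l !mulf_neq0 ?invr_eq0 ?expf_neq0 ?natrL_neq0.
- exact: rpred_nat.
- by move=> a; rewrite !inE => /or4P[/eqP->|/eqP->|/eqP->|/orP[]/eqP->];
    mem_integers.
- have bE : b = l ^+ 4 / 5 by rewrite l4 mulrC mulKf.
  rewrite bE -[RHS](mulr0 ((l / 5) ^+ 5)) -(quintic_root_eq px0) TE.
  by field; rewrite ?natrL_neq0.
move=> Ow _ _ P1.
have : P ((1 - 4 * R) * b).
  rewrite -(subrK (5 * ((l / 5) * (x - 2)) ^+ 4) ((1 - 4 * R) * b)).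
  by apply: (idealD idP) => //; apply: (idealMr idP) => //; exact: integersX.
have OE := integers_subfield.
(* Mod 5, both 1 - 4 R and A' are 1 + R, and m is (t - 2)^2 = 1 mod P. *)
case/(prime_idealM prP).
- by apply: OE; mem_integers.
- exact: OE.
- move=> PR; case/negP: nr; apply: inertia_int.
  rewrite (_ : _%:~R = (1 - 4 * R) + 5 * R); last by rewrite /R; ring.
  by apply: (idealD idP) => //; apply: (idealMr idP) => //; apply: OE.
rewrite /b => /(idealN idP); rewrite opprK -exprMn.
have OAm : ring_of_integers K (A' * m) by mem_integers.
move/(prime_idealX prP (OE _ OAm)).
case/(prime_idealM prP (OE _ OA') (OE _ Om)) => [PA|Pm].
  case/negP: nr; apply: inertia_int.
  rewrite (_ : _%:~R = A' - 5 * (R + 5 * R ^+ 2)); last by rewrite /A' /R; ring.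
  by apply: (idealB idP) => //; apply: (idealMr idP) => //; apply: OE; mem_integers.
apply: (prime_ideal1 prP).
rewrite (_ : 1 = m - y * y - 5 * (10 * R + 125 * R ^+ 2)); last first.
  by rewrite /m TE; ring.
apply: (idealB idP); last by apply: (idealMr idP) => //; apply: OE; mem_integers.
by apply: (idealB idP) => //; apply: (idealMr idP) => //; apply: OE.
Qed.

(* (x - 2) / 5 is integral over K, of trace - 2. *)
Lemma inertia_t3_unramified (r : int) : t = - 22 + 125 * r -> False.
Proof.
move=> tE; have P5 := inertia_prime5.
have n5 : 5 != 0 :> L by rewrite natrL_neq0.
pose R : L := r%:~R.
have TE : T = - 22 + 125 * R by rewrite tE rmorphD rmorphM rmorphN /= !rmorph_nat.
have OR : ring_of_integers K R by exact: integers_int.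
(* With t = 3 + 25 k, p(X + 2) = X^5 + 10 X^4 + 50 X^3 + 125 (1 - k) X^2 + 125 (1 - 4 k) X - 625 k
   (1 + k). Here k = 5 r - 1, so p(5 X + 2) / 5^5 has integral coefficients. *)
have [] := @affine_inertia_coefs 5^-1 2 (- (R * (5 * R - 1)))
  (1 - 4 * R) (2 - 5 * R) 2 2.
- by rewrite rpredV rpred_nat.
- by rewrite invr_eq0.
- exact: rpred_nat.
- by move=> a; rewrite !inE => /or4P[/eqP->|/eqP->|/eqP->|/orP[]/eqP->];
    mem_integers.
- rewrite -[RHS](mulr0 (5^-1 ^+ 5)) -(quintic_root_eq px0) TE.
  by field; rewrite ?natrL_neq0.
move=> Ow P2 _ _; apply: (prime_ideal1 prP); set w := _^-1 * _ in Ow P2.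
rewrite (_ : 1 = 5 - 2 * (2 + 5 * w) + 5 * (2 * w)); last by ring.
apply: (idealD idP); last first.
  by apply: (idealMr idP) => //; apply: integersM => //; exact: integers_nat.
by apply: (idealB idP) => //; apply: (idealMl idP) => //; exact: integers_nat.
Qed.
End FinitePlace.

(** * Unramifiedness at finite and infinite places *)

Lemma quintic_unramified_finite :
    [\/ (t = - 5 %[mod 25])%Z, (t = 1 %[mod 25])%Z,
        (t = 3 %[mod 25])%Z | (t = 9 %[mod 25])%Z] ->
  unramified_at_finite_places K E.
Proof.
move=> ht P prP [a Pa a0].
have [x [px0 E_x galKE oG]] := quintic_galois.
apply: (unramified_of_trivial_inertia galKE prP Pa a0) => s sG s1.
apply: NNPP => no_c.
have Ps c : ring_of_integers E c -> P (s c - c).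
  by move=> Oc; apply: NNPP => nPc; apply: no_c; exists c.
have tr c e := inertia_totally_ramified (c := c) (e := e) prP px0 E_x oG sG s1 Ps.
(* Mod 5, p is X^5 - (t^2 - t + 1), so its fivefold root c is t^2 - t + 1: 1 for t = -5 and 1, 2 for
   t = 3, 3 for t = 9. The second argument of [tr] is p(c) / 25. *)
case: ht => /eqz_modP[k tE].
- apply: (tr 1 (- 1 + 6 * k - 25 * k ^+ 2)); rewrite tE; first by ring.
    by apply: (@ndvd5_eq (2 - 10 * k) 4) => //; ring.
  (* [m] and [n] are the quotients of t^2 + 16 and (t - 2)^2 by 5, here and below. *)
  pose m := 8 - 50 * k + 125 * k ^+ 2; pose n := 9 - 70 * k + 125 * k ^+ 2.
  by apply: (@ndvd5_eq (5 * m * n + 4 * m + n) 4) => //; rewrite /m /n; ring.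
- apply: (tr 1 (- 1 - 6 * k - 25 * k ^+ 2)); rewrite tE; first by ring.
    by apply: (@ndvd5_eq (- 10 * k) 2) => //; ring.
  pose m := 3 + 10 * k + 125 * k ^+ 2; pose n := - 10 * k + 125 * k ^+ 2.
  by apply: (@ndvd5_eq (5 * m * n + m + 2 * n) 2) => //; rewrite /m /n; ring.
(* For t = 3 + 25 k, 5 divides t^2 + 16, so [tr] does not apply. *)
- have [/dvdzP[r kE]|k5] := boolP (5 %| 1 + k)%Z; last first.
    exact: (inertia_t3_ramified prP px0 E_x oG sG s1 Ps tE k5).
  apply: (inertia_t3_unramified (r := r) prP px0 E_x oG sG s1 Ps).
  by rewrite tE (_ : k = r * 5 - 1); [ring | rewrite -kE; ring].
apply: (tr 3 (- 1 - 62 * k - 25 * k ^+ 2)); rewrite tE; first by ring.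
  by apply: (@ndvd5_eq (15 - 30 * k) 3) => //; ring.
pose m := 19 + 90 * k + 125 * k ^+ 2; pose n := 9 + 70 * k + 125 * k ^+ 2.
by apply: (@ndvd5_eq (5 * m * n + 4 * m + 2 * n) 8) => //; rewrite /m /n; ring.
Qed.

(* K is totally imaginary. *)
Lemma quartic_no_real_place : unramified_at_infinite_places K E.
Proof.
move=> s s_real; exfalso.
pose z := s y; have zR : z \is Num.real by apply: s_real; apply: memv_adjoin.
have z_eq : z ^+ 4 + 5 * (t%:~R ^+ 2 + 16) * z ^+ 2
            + 5 * (t%:~R ^+ 2 + 16) * (t%:~R - 2) ^+ 2 = 0.
  rewrite -(rmorph0 s) -quartic_root_eq /z.
  by rewrite !(rmorph_nat, rmorph_int, rmorphXn, rmorphM, rmorphN, rmorphD).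
have A0 : 0 < 5 * ((t%:~R : algC) ^+ 2 + 16).
  rewrite mulr_gt0 ?ltr0n // ltr_wpDl ?ltr0n //.
  by rewrite real_exprn_even_ge0 ?Rreal_int.
have t0 : 0 < ((t%:~R : algC) - 2) ^+ 2.
  rewrite real_exprn_even_gt0 ?rpredB ?Rreal_int ?realn //=.
  by rewrite subr_eq0 (eqr_int _ t 2); case: (irreducible_quarticP_neq irr_q).
have : 0 < z ^+ 4 + 5 * (t%:~R ^+ 2 + 16) * z ^+ 2
            + 5 * (t%:~R ^+ 2 + 16) * (t%:~R - 2) ^+ 2.
  apply: ltr_wpDl; last exact: mulr_gt0.
  apply: addr_ge0; first by rewrite real_exprn_even_ge0.
  by apply: mulr_ge0; [exact: ltW | rewrite real_exprn_even_ge0].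
by rewrite z_eq ltxx.
Qed.
End Quintic.
End Quartic.

Theorem theorem4 (t : int)
  (ht : [\/ (t = - 5 %[mod 25])%Z, (t = 1 %[mod 25])%Z,
            (t = 3 %[mod 25])%Z | (t = 9 %[mod 25])%Z])
  (hq : irreducible_poly (quarticP t))
  (L : splittingFieldType rat) (y : L)
  (hy : root (map_poly (in_alg L) (quarticP t)) y) :
  cyclic_extension 1%AS <<1; y>>%AS /\
  (irreducible_poly (quinticP t) ->
   forall E : {subfield L},
     splittingFieldFor <<1; y>>%AS (map_poly (in_alg L) (quinticP t)) E ->
     cyclic_extension <<1; y>>%AS E /\ unramified_extension <<1; y>>%AS E).
Proof.
split; first exact: (quartic_cyclic hq hy).
move=> irr_p E split_E; split; last first.
  split; first exact: (quintic_unramified_finite hq hy irr_p split_E ht).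
  exact: (quartic_no_real_place hq hy).
have [x [_ _ galKE oG]] := quintic_galois hq hy irr_p split_E.
by split=> //; apply: prime_cyclic; rewrite oG.
Qed.
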